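(* With $f(x)=\sum_{t\in\mathcal T}\sum_{(u,v)\in\tilde E}d_{uv}x_{tuv}$ and the feasible regions $P_{basic}$ and $P_F$ defined in the context, $$\min\{f(x):(x,y,z,\alpha,\beta,\gamma,\sigma)\in P_F\}=\min\{f(x):(x,y,z)\in P_{basic}\}.$$
   Context: **Warehouse graph.** A rectangular warehouse has vertical picking aisles crossed by horizontal cross-aisles. The part between two adjacent cross-aisles is a block, and the section of a picking aisle inside a block is a subaisle. Subaisles are indexed by $[W_{sub}]=\{1,\dots,W_{sub}\}$. $V_I$ is the finite set of artificial locations (the endpoints of subaisles, i.e. the crossings of picking aisles and cross-aisles). $V_L$ is the finite set of picking locations, each lying strictly inside a subaisle. $V=V_I\cup V_L$. The origin $s\in V_I$ is the top-left artificial location. $\tilde E$ consists of both directed arcs $(u,v),(v,u)$ for every pair of neighboring locations within a picking aisle and every pair of neighboring artificial locations within a cross-aisle; $d_{uv}=d_{vu}>0$ is the distance between $u$ and $v$. For a subaisle $i$: $V_{sub}(i)$ is its set of picking locations, $f(i)$ its northern and $l(i)$ its southern artificial location. For a location $v$, $n(v)$ and $s(v)$ denote the adjacent northern and southern location in its picking aisle (so $s(f(i))$ and $n(l(i))$ are the first and last picking locations of subaisle $i$). $\tilde E'$ is the arc set of the reduced graph on $V_I$: both directed arcs between horizontally neighboring artificial locations of a cross-aisle (''horizontal arcs''), and both arcs $(f(i),l(i)),(l(i),f(i))$ for each subaisle $i$. For $S\subset V$, $\delta^+(S)$ / $\delta^-(S)$ are the arcs of $\tilde E$ leaving / entering $S$;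 for $S\subset V_I$, $\eta^+(S)$ / $\eta^-(S)$ are the arcs of $\tilde E'$ leaving / entering $S$; write $\delta^\pm(v)=\delta^\pm(\{v\})$, $\eta^\pm(v)=\eta^\pm(\{v\})$. **Orders and pickers.** $O$ is a finite set of orders; order $o$ has size $b_o$ and picking location set $L_o\subset V_L$. Each picker has capacity $B$. $\mathcal T=\{1,\dots,T\}$ is the set of pickers, where $T$ is the minimum number of pickers needed to carry all orders (the optimal value of the bin-packing problem with item sizes $b_o$ and bin capacity $B$). **$P_{basic}$**: all $(x,y,z)$ with $x_{tuv}\in\{0,1\}$ ($t\in\mathcal T,(u,v)\in\tilde E$), $y_{tv}\in\{0,1\}$ ($t\in\mathcal T,v\in V$), $z_{ot}\in\{0,1\}$ ($o\in O,t\in\mathcal T$) such that: (B1) $\sum_{(s,v)\in\delta^+(s)}x_{tsv}\ge1$ for all $t$; (B2) $\sum_{(u,v)\in\delta^+(u)}x_{tuv}\ge z_{ot}$ for all $t,o$, $u\in L_o$; (B3) $y_{tu}\ge x_{tuv}$ for all $t$, $u\in V\setminus\{s\}$, $(u,v)\in\delta^+(u)$; (B4) $\sum_{(u,v)\in\delta^+(S)}x_{tuv}\ge y_{tu_0}$ for all $t$, $S\subset V\setminus\{s\}$ with $|S|\ge2$, $u_0\in S$; (B5) $\sum_{(v,u)\in\delta^+(v)}x_{tvu}=\sum_{(u,v)\in\delta^-(v)}x_{tuv}$ for all $t$, $v\in V$; (B6) $\sum_{t\in\mathcal T}z_{ot}=1$ for all $o$; (B7) $\sum_{o\in O}b_oz_{ot}\le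 B$ for all $t$. **$P_{sub}$**: all $(x,z,\alpha,\beta)$ with $\alpha_{tv},\beta_{tv}\in\{0,1\}$ ($t\in\mathcal T$, $v\in V_L$) such that, for all $t$ and $i\in[W_{sub}]$: $\alpha_{tv}\ge\alpha_{t,s(v)}$ for $v\in V_{sub}(i)\setminus\{n(l(i))\}$; $x_{t,n(v),v}\ge\alpha_{tv}$ for $v\in V_{sub}(i)$; $\beta_{tv}\ge\beta_{t,n(v)}$ for $v\in V_{sub}(i)\setminus\{s(f(i))\}$; $x_{t,s(v),v}\ge\beta_{tv}$ for $v\in V_{sub}(i)$; and $\alpha_{tv}+\beta_{tv}\ge z_{ot}$ for all $t$, $o\in O$, $v\in L_o$. **$P_F$**: all $(x,y,z,\alpha,\beta,\gamma,\sigma)$ with $x_{tuv}\in\{0,1\}$ ($t\in\mathcal T,(u,v)\in\tilde E$), $y_{tv}\in\{0,1\}$ ($t\in\mathcal T,v\in V$), $z_{ot}\in\{0,1\}$ ($o\in O,t\in\mathcal T$), $\gamma_{tuv}\in\{0,1\}$ ($t\in\mathcal T,(u,v)\in\tilde E'$), real variables $\sigma^{v_0}_{tuv}$ ($t\in\mathcal T$, $v_0\in V_I$, $(u,v)\in\tilde E'$), $(x,z,\alpha,\beta)\in P_{sub}$, satisfying (B1), (B2), (B5), (B6), (B7) and: (G1) $y_{tu}\ge x_{tuv}$ for all $t$, $u\in V_I\setminus\{s\}$, $(u,v)\in\delta^+(u)$; (G2) $x_{tvw}=\gamma_{tvw}$ for all $t$ and all horizontal arcs $(v,w)\in\tilde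 E'$; (G3) $\alpha_{t,n(l(i))}\ge\gamma_{t,f(i),l(i)}$ and $x_{t,n(l(i)),l(i)}\ge\gamma_{t,f(i),l(i)}$ for all $t,i$; (G4) $\beta_{t,s(f(i))}\ge\gamma_{t,l(i),f(i)}$ and $x_{t,s(f(i)),f(i)}\ge\gamma_{t,l(i),f(i)}$ for all $t,i$; (F1) $\sum_{(v_0,v)\in\eta^+(v_0)}\sigma^{v_0}_{tv_0v}-\sum_{(v,v_0)\in\eta^-(v_0)}\sigma^{v_0}_{tvv_0}=y_{tv_0}$ for all $t$, $v_0\in V_I$; (F2) $\sum_{(u,v)\in\eta^+(u)}\sigma^{v_0}_{tuv}-\sum_{(v,u)\in\eta^-(u)}\sigma^{v_0}_{tvu}=0$ for all $t$, $v_0\in V_I$, $u\in V_I\setminus\{s,v_0\}$; (F3) $\sum_{(s,v)\in\eta^+(s)}\sigma^{v_0}_{tsv}-\sum_{(v,s)\in\eta^-(s)}\sigma^{v_0}_{tvs}=-y_{tv_0}$ for all $t$, $v_0\in V_I$; (F4) $0\le\sigma^{v_0}_{tuv}\le\gamma_{tuv}$ for all $t$, $v_0\in V_I$, $(u,v)\in\tilde E'$. If $V_{sub}(i)=\emptyset$, then $n(l(i))=f(i)$, $s(f(i))=l(i)$, and the constraints of (G3), (G4) involving $\alpha$, $\beta$ are omitted for that $i$. *)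

(* Defs.v *)
From mathcomp Require Import all_boot all_order all_algebra.
From mathcomp Require Import reals.

Set Implicit Arguments.
Unset Strict Implicit.
Unset Printing Implicit Defensive.

Import Order.TTheory GRing.Theory Num.Theory.
Local Open Scope ring_scope.

Definition arcs_out (U : finType) (E : {set U * U}) (S : {set U}) :
  {set U * U} := [set e in E | (e.1 \in S) && (e.2 \notin S)].
Definition arcs_in (U : finType) (E : {set U * U}) (S : {set U}) :
  {set U * U} := [set e in E | (e.1 \notin S) && (e.2 \in S)].

(* [blocks] blocks are delimited by [blocks.+1] cross-aisles.  Aisles are
   numbered from left to right, blocks and cross-aisles from top to bottom. *)
Record warehouse := Warehouse {
  aisles : nat;
  blocks : nat;
  aisles_gt0 : (0 < aisles)%N;
  blocks_gt0 : (0 < blocks)%N;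
  npick : 'I_aisles * 'I_blocks -> nat
}.

Section Locations.
Variable W : warehouse.

(* The subaisle (a, b) is the part of aisle a inside block b. *)
Definition subaisle : finType := ('I_(aisles W) * 'I_(blocks W))%type.

(* V_I: the artificial location (a, c) is the crossing of aisle a and
   cross-aisle c. *)
Definition artificial : finType :=
  ('I_(aisles W) * 'I_(blocks W).+1)%type.

(* V_L: the picking locations of a subaisle are numbered from north to south. *)
Definition picking : finType := {i : subaisle & 'I_(npick i)}.

(* V = V_I + V_L *)
Definition location : finType := (artificial + picking)%type.

Definition origin : artificial := (Ordinal (aisles_gt0 W), ord0).

Definition northern (i : subaisle) : artificial := (i.1, lift ord_max i.2).
Definition southern (i : subaisle) : artificial := (i.1, lift ord0 i.2).

(* The k-th location of subaisle i from the north: its northern artificial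
   location for k = 0, its picking locations for 1 <= k <= npick i, and its
   southern artificial location for larger k. *)
Definition site (i : subaisle) (k : nat) : location :=
  if k is k'.+1 then
    if insub k' : option 'I_(npick i) is Some j
    then inr (Tagged (fun i : subaisle => 'I_(npick i)) j)
    else inl (southern i)
  else inl (northern i).

(* n(v) and s(v).  At the northern (southern) end of an aisle, where there is
   no such location, the value is v itself.  If subaisle i has no picking
   location, then north (southern i) = northern i and
   south (northern i) = southern i. *)
Definition north (v : location) : location :=
  match v with
  | inl (a, c) =>
      if unlift ord0 c is Some b then site (a, b) (npick (a, b)) else v
  | inr p => site (tag p) (tagged p)
  end.
Definition south (v : location) : location :=
  match v with
  | inl (a, c) =>
      if unlift ord_max c is Some b then site (a, b) 1 else v
  | inr p => site (tag p) (tagged p).+2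
  end.

Definition horizontal (u v : artificial) : bool :=
  (u.2 == v.2) && ((u.1.+1 == v.1 :> nat) || (v.1.+1 == u.1 :> nat)).

Definition vertical (u v : location) : bool :=
  (u != v) && ((v == north u) || (v == south u)).

(* the full arc set *)
Definition E : {set location * location} :=
  [set e | vertical e.1 e.2
    || match e with (inl u, inl v) => horizontal u v | _ => false end].

(* the arc set of the reduced graph *)
Definition E' : {set artificial * artificial} :=
  [set e | horizontal e.1 e.2
    || [exists i, (e == (northern i, southern i))
                  || (e == (southern i, northern i))]].

Definition delta_out (S : {set location}) := arcs_out E S.
Definition delta_in (S : {set location}) := arcs_in E S.
Definition eta_out (S : {set artificial}) := arcs_out E' S.
Definition eta_in (S : {set artificial}) := arcs_in E' S.

End Locations.

Section BinPacking.
Variables (R : realType) (O : finType) (b : O -> R) (B : R).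

Definition packable (n : nat) : Prop :=
  exists g : O -> 'I_n, forall t, \sum_(o | g o == t) b o <= B.

Definition min_bins (n : nat) : Prop :=
  packable n /\ forall m, packable m -> (n <= m)%N.

End BinPacking.

(* Binary variables are booleans, coerced to 0 or 1.  A variable indexed by
   arcs is a function on all pairs; its values outside the arc set occur in no
   constraint and not in the objective. *)
Section Models.
Variables (R : realType) (W : warehouse) (d : location W * location W -> R).
Variables (O : finType) (b : O -> R) (L : O -> {set picking W}) (B : R).
Variable T : nat.

Local Notation V := (location W).
Local Notation VI := (artificial W).
Local Notation VL := (picking W).
Local Notation s := (origin W).

Implicit Types (x : 'I_T -> V * V -> bool) (y : 'I_T -> V -> bool).
Implicit Types (z : O -> 'I_T -> bool) (alpha beta : 'I_T -> VL -> bool).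
Implicit Types (gamma : 'I_T -> VI * VI -> bool).
Implicit Types (sigma : 'I_T -> VI -> VI * VI -> R).

Definition cost x : R := \sum_t \sum_(e in E W) d e * (x t e)%:R.

Definition B1 x : Prop := forall t,
  (1 <= \sum_(e in delta_out [set inl s]) x t e)%N.
Definition B2 x z : Prop := forall t o u, u \in L o ->
  (z o t <= \sum_(e in delta_out [set inr u]) x t e)%N.
Definition B3 x y : Prop := forall t (u : V), u != inl s ->
  forall e, e \in delta_out [set u] -> (x t e <= y t u)%N.
Definition B4 x y : Prop := forall t (S : {set V}),
  inl s \notin S -> (2 <= #|S|)%N -> forall u0, u0 \in S ->
  (y t u0 <= \sum_(e in delta_out S) x t e)%N.
Definition B5 x : Prop := forall t (v : V),
  (\sum_(e in delta_out [set v]) x t e = \sum_(e in delta_in [set v]) x t e)%N.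
Definition B6 z : Prop := forall o, (\sum_t z o t = 1)%N.
Definition B7 z : Prop := forall t, \sum_o b o * (z o t)%:R <= B.

Record P_basic x y z : Prop := {
  basic_B1 : B1 x;
  basic_B2 : B2 x z;
  basic_B3 : B3 x y;
  basic_B4 : B4 x y;
  basic_B5 : B5 x;
  basic_B6 : B6 z;
  basic_B7 : B7 z
}.

(* The condition [south (inr v) = inr w] says that w = s(v) is a picking
   location, so that v is not the last picking location of its subaisle;
   likewise for [north]. *)
Record P_sub x z alpha beta : Prop := {
  sub_alpha_chain : forall t (v w : VL), south (inr v) = inr w ->
    (alpha t w <= alpha t v)%N;
  sub_alpha_arc : forall t (v : VL),
    (alpha t v <= x t (north (inr v), inr v))%N;
  sub_beta_chain : forall t (v w : VL), north (inr v) = inr w ->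
    (beta t w <= beta t v)%N;
  sub_beta_arc : forall t (v : VL),
    (beta t v <= x t (south (inr v), inr v))%N;
  sub_cover : forall t o (v : VL), v \in L o ->
    (z o t <= alpha t v + beta t v)%N
}.

Definition G1 x y : Prop := forall t (u : VI), u != s ->
  forall e, e \in delta_out [set inl u] -> (x t e <= y t (inl u))%N.
Definition G2 x gamma : Prop := forall t (v w : VI), horizontal v w ->
  x t (inl v, inl w) = gamma t (v, w).
(* In G3 and G4 the constraints on alpha and beta are void when subaisle i has
   no picking location, since then the neighbor is an artificial location. *)
Definition G3 x alpha gamma : Prop := forall t (i : subaisle W),
  let l := inl (southern i) in
  (forall v : VL, north l = inr v ->
     (gamma t (northern i, southern i) <= alpha t v)%N)
  /\ (gamma t (northern i, southern i) <= x t (north l, l))%N.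
Definition G4 x beta gamma : Prop := forall t (i : subaisle W),
  let f := inl (northern i) in
  (forall v : VL, south f = inr v ->
     (gamma t (southern i, northern i) <= beta t v)%N)
  /\ (gamma t (southern i, northern i) <= x t (south f, f))%N.

Definition net_outflow sigma t (v0 u : VI) : R :=
  \sum_(e in eta_out [set u]) sigma t v0 e
  - \sum_(e in eta_in [set u]) sigma t v0 e.

Definition F1 y sigma : Prop := forall t (v0 : VI),
  net_outflow sigma t v0 v0 = (y t (inl v0))%:R.
Definition F2 sigma : Prop := forall t (v0 u : VI), u != s -> u != v0 ->
  net_outflow sigma t v0 u = 0.
(* The case v0 = s is included, so F1 and F3 together force y t s = 0. *)
Definition F3 y sigma : Prop := forall t (v0 : VI),
  net_outflow sigma t v0 s = - (y t (inl v0))%:R.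
Definition F4 gamma sigma : Prop := forall t (v0 : VI) e, e \in E' W ->
  0 <= sigma t v0 e <= (gamma t e)%:R.

Record P_F x y z alpha beta gamma sigma : Prop := {
  F_sub : P_sub x z alpha beta;
  F_B1 : B1 x;
  F_B2 : B2 x z;
  F_B5 : B5 x;
  F_B6 : B6 z;
  F_B7 : B7 z;
  F_G1 : G1 x y;
  F_G2 : G2 x gamma;
  F_G3 : G3 x alpha gamma;
  F_G4 : G4 x beta gamma;
  F_F1 : F1 y sigma;
  F_F2 : F2 sigma;
  F_F3 : F3 y sigma;
  F_F4 : F4 gamma sigma
}.

Definition basic_value (m : R) : Prop :=
  exists x y z, P_basic x y z /\ m = cost x.
Definition F_value (m : R) : Prop :=
  exists x y z alpha beta gamma sigma,
    P_F x y z alpha beta gamma sigma /\ m = cost x.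

End Models.

Definition is_min (R : realType) (A : R -> Prop) (m : R) : Prop :=
  A m /\ forall a, A a -> m <= a.

(* Main.v *)
Require Import Defs.
From mathcomp Require Import all_boot all_order all_algebra.
From mathcomp Require Import boolp reals.
Import Order.TTheory GRing.Theory Num.Theory.
Local Open Scope ring_scope.

(** Call a set of locations closed when no used arc leaves it.  Since the used
    arcs are balanced at every location, the complement of a closed set is
    closed.

    From the basic model to the flow model, x is unchanged, and alpha, beta and
    gamma record the maximal straight runs of used arcs from the ends of the
    subaisles.  Given a set C of artificial locations closed under gamma, adding
    the picking locations reached by such runs from C gives a closed set
    ([spread]).  For C the set reachable from v0, (B4) shows that C contains the
    origin, and a path carries the unit flow; for C the set of all artificial
    locations, (B4) applied to the complement shows that alpha and beta cover
    every served location.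

    Conversely, restrict x to the arcs leaving the set reached from the origin.
    The flow sigma shows that every artificial location with a used outgoing arc
    is reached, hence so is every served location, and the cost does not
    increase. *)

(** * Cuts, balance and closed sets in a directed graph *)

Section Cuts.
Context {U : finType} (A : {set U * U}).

(** Arcs with both ends in [S] occur in both sums on the right and cancel. *)
Lemma cut_difference (M : zmodType) (f : U * U -> M) (S : {set U}) :
  \sum_(e in arcs_out A S) f e - \sum_(e in arcs_in A S) f e
  = \sum_(e in A | e.1 \in S) f e - \sum_(e in A | e.2 \in S) f e.
Proof.
rewrite (bigID (fun e => e.2 \in S) (fun e => (e \in A) && (e.1 \in S))) /=.
rewrite (bigID (fun e => e.1 \in S) (fun e => (e \in A) && (e.2 \in S))) /=.
rewrite opprD addrACA.
rewrite [X in _ = X - _ + _](eq_bigl (fun e => (e \in A) && (e.2 \in S) && (e.1 \in S)));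
  last by move=> e; rewrite andbAC.
rewrite subrr add0r; congr (_ - _); apply: eq_bigl => e;
  by rewrite inE -andbA // [(e.1 \notin S) && _]andbC.
Qed.

Lemma sum_cut_difference (M : zmodType) (f : U * U -> M) (S : {set U}) :
  \sum_(u in S) (\sum_(e in arcs_out A [set u]) f e
                 - \sum_(e in arcs_in A [set u]) f e)
  = \sum_(e in arcs_out A S) f e - \sum_(e in arcs_in A S) f e.
Proof.
have split_by (g : U * U -> U) :
    \sum_(u in S) \sum_(e in A | g e \in [set u]) f e
    = \sum_(e in A | g e \in S) f e.
  rewrite [RHS](partition_big g (mem S)) => [|e /andP[]//].
  apply: eq_bigr => u uS; apply: eq_bigl => e.
  by rewrite inE -andbA; case: eqP => [->|]; rewrite ?uS ?andbF.
rewrite cut_difference -!split_by -sumrB.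
by apply: eq_bigr => u _; rewrite cut_difference.
Qed.

Lemma mem_arcs_out (S : {set U}) u v :
  ((u, v) \in arcs_out A S) = [&& (u, v) \in A, u \in S & v \notin S].
Proof. by rewrite in_set. Qed.

Variable x : U * U -> bool.

(** The closedness of the overview: arcs of [A] selected by [x] never leave [S]. *)
Definition stays (S : {set U}) : Prop :=
  forall u v, (u, v) \in A -> x (u, v) -> u \in S -> v \in S.

Lemma staysP (S : {set U}) :
  stays S <-> (\sum_(e in arcs_out A S) x e = 0)%N.
Proof.
split=> [stS|/eqP]; last first.
  rewrite sum_nat_eq0 => /forall_inP H u v uvA xuv uS.
  apply: contraT => vS; have := H (u, v).
  by rewrite inE uvA /= uS vS xuv => /(_ isT).
apply: big1 => -[u v]; rewrite inE /= => /andP[uvA /andP[uS]].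
by case xuv: (x _) => //; rewrite (stS _ _ uvA xuv uS).
Qed.

Lemma cut_gt0 (S : {set U}) :
  ~ stays S -> (0 < \sum_(e in arcs_out A S) x e)%N.
Proof. by move=> nS; rewrite lt0n; apply/eqP => /staysP. Qed.

Hypothesis bal : forall v,
  (\sum_(e in arcs_out A [set v]) x e = \sum_(e in arcs_in A [set v]) x e)%N.

Lemma balanced_cut (S : {set U}) :
  (\sum_(e in arcs_out A S) x e = \sum_(e in arcs_in A S) x e)%N.
Proof.
apply/eqP; rewrite -(eqr_nat int) !natr_sum -subr_eq0 -sum_cut_difference.
by rewrite big1 // => v _; rewrite -!natr_sum bal subrr.
Qed.

(** By balance the flow into [S] vanishes along with the flow out of it, and entering [S] is leaving
    its complement. *)
Lemma staysC (S : {set U}) : stays S -> stays (~: S).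
Proof.
move=> /staysP; rewrite balanced_cut => in0; apply/staysP; rewrite -[RHS]in0.
by apply: eq_bigl => e; rewrite !inE negbK.
Qed.

End Cuts.

(** * Positions along a subaisle and classification of the arcs *)

Section Sites.
Context {W : warehouse}.
Implicit Types (i : subaisle W) (u v w : location W) (k : nat).

Lemma site_picking (p : picking W) :
  inr p = site (tag p) (tagged p).+1 :> location W.
Proof. by case: p => i j; rewrite /= valK. Qed.

Definition pick_at {i k} (ki : (k < npick i)%N) : picking W :=
  Tagged (fun i => 'I_(npick i)) (Ordinal ki).

Lemma site_inr {i k} (ki : (k < npick i)%N) : site i k.+1 = inr (pick_at ki).
Proof. by rewrite /= insubT. Qed.

Lemma site_last i : site i (npick i).+1 = inl (southern i).
Proof. by rewrite /= insubN // ltnn. Qed.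

Lemma north_southern i : north (inl (southern i)) = site i (npick i).
Proof. by case: i => a c; rewrite /north /southern /= liftK. Qed.

Lemma south_northern i : south (inl (northern i)) = site i 1.
Proof. by case: i => a c; rewrite /south /northern liftK. Qed.

Lemma north_site i k : (k <= npick i)%N -> north (site i k.+1) = site i k.
Proof.
rewrite leq_eqVlt => /predU1P[->|ki]; last by rewrite (site_inr ki).
by rewrite site_last north_southern.
Qed.

Lemma south_site i k : (k <= npick i)%N -> south (site i k) = site i k.+1.
Proof.
by case: k => [_|k ki]; [exact: south_northern | rewrite (site_inr ki)].
Qed.

Lemma siteSP u :
  north u = u \/ exists i k, (k <= npick i)%N /\ u = site i k.+1.
Proof.
case: u => [[a c]|p]; last first.
  by right; exists (tag p), (tagged p); rewrite -site_picking ltnW.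
rewrite [X in X = _]/=; case: unliftP => [b ->|_]; last by left.
by right; exists (a, b), (npick (a, b)); rewrite site_last.
Qed.

Lemma siteP u :
  south u = u \/ exists i k, (k <= npick i)%N /\ u = site i k.
Proof.
case: u => [[a c]|p]; last first.
  by right; exists (tag p), (tagged p).+1; rewrite -site_picking.
rewrite [X in X = _]/=; case: unliftP => [b ->|_]; last by left.
by right; exists (a, b), 0%N.
Qed.

Lemma site_neqS i k : (k <= npick i)%N -> site i k != site i k.+1.
Proof.
case: k => [_|k ki].
  have [i0|i0] := posnP (npick i); last by rewrite (site_inr i0).
  (* Without picking locations, position 1 is already the southern end. *)
  have -> : 1%N = (npick i).+1 by rewrite i0.
  rewrite site_last; apply/eqP => -[].
  by rewrite /bump leqNgt ltn_ord => /n_Sn.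
rewrite (site_inr ki); have [ki'|ik] := ltnP k.+1 (npick i); last first.
  have -> : k.+2 = (npick i).+1 by congr _.+1; apply/anti_leq/andP.
  by rewrite site_last.
by rewrite (site_inr ki'); apply/eqP => -[] /n_Sn.
Qed.

(** The bound on [k] includes [npick i]: position [(npick i).+1] is the southern artificial
    location, so the two end arcs of a subaisle need no separate case. *)
Variant arc_spec : location W -> location W -> Prop :=
  | ArcDown i k of (k <= npick i)%N : arc_spec (site i k) (site i k.+1)
  | ArcUp i k of (k <= npick i)%N : arc_spec (site i k.+1) (site i k)
  | ArcHorizontal a b of horizontal a b : arc_spec (inl a) (inl b).

Lemma arcP u v : (u, v) \in E W <-> arc_spec u v.
Proof.
split; last first.
  have vert w w' : vertical w w' -> (w, w') \in E W by rewrite inE /= => ->.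
  case=> [i k ki|i k ki|a b ab]; last by rewrite inE /= ab orbT.
    by apply: vert; rewrite /vertical site_neqS // south_site ?eqxx ?orbT.
  by apply: vert; rewrite /vertical eq_sym site_neqS // north_site ?eqxx.
rewrite inE /= => /orP[/andP[uv /predU1P[e|/eqP e]]|]; last first.
- by case: u v => [a|?] [b|?] //; exact: ArcHorizontal.
(* At the southern end of an aisle [south u] defaults to [u], which [vertical] excludes. *)
- have [us|[i [k [ki us]]]] := siteP u; first by rewrite e us eqxx in uv.
  by rewrite e us south_site //; exact: ArcDown.
- have [us|[i [k [ki us]]]] := siteSP u; first by rewrite e us eqxx in uv.
  by rewrite e us north_site //; exact: ArcUp.
Qed.

Lemma E_sym u v : (u, v) \in E W -> (v, u) \in E W.
Proof.
move=> /arcP uv; apply/arcP; case: uv => [i k|i k|a b ab]; [exact: ArcUp| exact: ArcDown|].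
by apply: ArcHorizontal; rewrite /horizontal eq_sym orbC.
Qed.

Variant arc'_spec : artificial W -> artificial W -> Prop :=
  | Arc'Down i : arc'_spec (northern i) (southern i)
  | Arc'Up i : arc'_spec (southern i) (northern i)
  | Arc'Horizontal a b of horizontal a b : arc'_spec a b.

Lemma arc'P a b : (a, b) \in E' W <-> arc'_spec a b.
Proof.
rewrite inE /=; split=> [/orP[ab|/existsP[i /orP[] /eqP[-> ->]]]|].
- exact: Arc'Horizontal.
- exact: Arc'Down.
- exact: Arc'Up.
case=> [i|i|{}a {}b ->//]; rewrite orbC; apply/orP; left;
  by apply/existsP; exists i; rewrite eqxx ?orbT.
Qed.

(* North along the aisle, then left along the top cross-aisle. *)
Lemma stays_origin (S : {set location W}) u :
  stays (E W) xpredT S -> u \in S -> inl (origin W) \in S.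
Proof.
move=> stS.
have up i k : (k <= npick i)%N -> site i k \in S -> inl (northern i) \in S.
  elim: k => // k IH ki kS; apply: IH (ltnW ki) _.
  by apply: stS kS => //; apply/arcP/ArcUp/ltnW.
have row a : inl (a, ord0) \in S -> inl (origin W) \in S.
  case: a => a aW; elim: a aW => [|a IH] aW aS.
    by rewrite /origin (_ : Ordinal _ = Ordinal aW) //; exact: val_inj.
  apply: (IH (ltnW aW)); apply: stS aS => //; apply/arcP/ArcHorizontal.
  by rewrite /horizontal /= !eqxx orbT.
have col a c : inl (a, c) \in S -> inl (origin W) \in S.
  case: c => c cW; elim: c cW => [|c IH] cW acS.
    by apply: (row a); rewrite (_ : ord0 = Ordinal cW) //; exact: val_inj.
  have cb : (c < blocks W)%N by [].
  pose i : subaisle W := (a, Ordinal cb).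
  apply: (IH (ltnW cW)).
  have -> : inl (a, Ordinal (ltnW cW)) = inl (northern i) :> location W.
    by congr (inl (_, _)); apply: val_inj; rewrite /= /bump leqNgt cb.
  have iS : inl (southern i) \in S.
    by congr (inl (_, _) \in S): acS; exact: val_inj.
  apply: (up i (npick i)) => //; apply: stS iS => //.
  by rewrite -site_last; apply/arcP/ArcUp.
case: u => [[a c]|p]; first exact: col.
by rewrite site_picking => pS; apply: (col _ _ (up _ _ _ pS)).
Qed.

End Sites.

Lemma leq_bool (a c : bool) : (a <= c)%N = (a ==> c).
Proof. by case: a; case: c. Qed.

Lemma connect_stays {U : finType} (A : {set U * U}) (x : U * U -> bool)
    (S : {set U}) u v :
  connect (fun a c => ((a, c) \in A) && x (a, c)) u v ->
  stays A x S -> u \in S -> v \in S.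
Proof.
move=> /connectP[p + ->] stS.
elim: p u => //= w p IH u /andP[/andP[uwA xuw]] pp uS.
exact: IH pp (stS _ _ uwA xuw uS).
Qed.

(** * Unit flows along paths *)

Section UnitFlow.
Context {R : numDomainType} {U : finType} (A : {set U * U}).

Definition net (f : U * U -> R) (u : U) : R :=
  \sum_(e in arcs_out A [set u]) f e - \sum_(e in arcs_in A [set u]) f e.

Lemma netD f g u : net (fun e => f e + g e) u = net f u + net g u.
Proof. by rewrite /net !big_split opprD addrACA. Qed.

Lemma net_arc (a c u : U) : (a, c) \in A ->
  net (fun e => (e == (a, c))%:R) u = (u == a)%:R - (u == c)%:R.
Proof.
move=> acA; rewrite /net cut_difference.
have pick1 (P : pred (U * U)) :
    \sum_(e | P e) (e == (a, c))%:R = (P (a, c))%:R :> R.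
  case: (boolP (P (a, c))) => Pac.
    by rewrite (bigD1 (a, c)) //= eqxx big1 ?addr0 // => e /andP[_ /negbTE ->].
  by rewrite big1 // => e Pe; case: eqP Pe Pac => // -> ->.
by rewrite !pick1 !inE acA /= [a == u]eq_sym [c == u]eq_sym.
Qed.

Variable r : rel U.
Hypothesis rA : forall u v, r u v -> (u, v) \in A.

(** The flow puts 1 on each arc of a path from [u] to [v]; shortening the path to a simple one keeps
    every arc value at most 1. *)
Lemma connect_flow u v : connect r u v ->
  exists f : U * U -> R,
    (forall a c, 0 <= f (a, c) <= (r a c)%:R)
    /\ forall w, net f w = (w == u)%:R - (w == v)%:R.
Proof.
move=> /connectP[p0 /shortenP[p pp up _] ->] {p0}.
(* The added vanishing clause ensures that the arc prepended in the induction carries no flow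
   yet. *)
suff [f [f01 _ fnet]] : exists f : U * U -> R,
    [/\ forall a c, 0 <= f (a, c) <= (r a c)%:R,
        forall a c, a \notin u :: p -> f (a, c) = 0
      & forall w, net f w = (w == u)%:R - (w == last u p)%:R] by exists f.
elim: p u pp up => [|c p IH] u /=.
  move=> _ _; exists (fun=> 0); split=> // [a c|w]; first by rewrite lexx ler0n.
  by rewrite /net !big1 // !subrr.
move=> /andP[ruc pp] /andP[ucp ucp'].
have [f [f01 f0 fnet]] := IH c pp ucp'.
exists (fun e => f e + (e == (u, c))%:R); split.
- move=> a a'; case: eqP => [[-> ->]|_]; last by rewrite addr0.
  by rewrite f0 // add0r ruc ler01 lexx.
- move=> a a'; rewrite inE negb_or => /andP[au acp].
  by rewrite f0 // add0r xpair_eqE (negbTE au).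
- move=> w; rewrite netD fnet net_arc ?rA //.
  by rewrite addrC addrA subrK.
Qed.

End UnitFlow.

(** * Straight runs in subaisles and closed sets of the reduced graph *)

Section Subaisles.
Context {W : warehouse} (x : location W * location W -> bool).
Implicit Types (i : subaisle W) (k : nat) (C : {set artificial W}).

Definition down i k := all (fun m => x (site i m, site i m.+1)) (iota 0 k).

(** Mirror image of [down]: the run goes from the southern end, position [(npick i).+1], north to
    position [k]. *)
Definition up i k :=
  all (fun m => x (site i m.+1, site i m)) (iota k ((npick i).+1 - k)).

Lemma downS i k : down i k.+1 = down i k && x (site i k, site i k.+1).
Proof. by rewrite /down -[in LHS](addn1 k) iotaD all_cat /= andbT. Qed.

Lemma upS i k : (k <= npick i)%N ->
  up i k = up i k.+1 && x (site i k.+1, site i k).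
Proof. by move=> ki; rewrite /up subSn // andbC. Qed.

Lemma up_last i : up i (npick i).+1.
Proof. by rewrite /up subnn. Qed.

Lemma down_first i k : down i k.+1 -> x (site i 0, site i 1).
Proof. by rewrite /down /= => /andP[]. Qed.

Lemma up_first i k : (k <= npick i)%N -> up i k ->
  x (site i (npick i).+1, site i (npick i)).
Proof. by move=> ki /allP; apply; rewrite mem_iota ki subnKC ?(leqW ki) /=. Qed.

Lemma stays_down (S : {set location W}) i k : (k <= (npick i).+1)%N ->
  stays (E W) x S -> inl (northern i) \in S -> down i k -> site i k \in S.
Proof.
move=> + stS nS; elim: k => // k IH ki.
rewrite downS => /andP[/(IH (ltnW ki)) kS xk].
by apply: stS xk kS; apply/arcP/ArcDown.
Qed.

Lemma stays_up (S : {set location W}) i k : (k <= (npick i).+1)%N ->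
  stays (E W) x S -> inl (southern i) \in S -> up i k -> site i k \in S.
Proof.
(* The induction is on the distance from the southern end. *)
move=> ki stS sS; rewrite -(subKn ki).
elim: (_ - k)%N (leq_subr k (npick i).+1) => [|m IH] mi.
  by rewrite subn0 site_last.
rewrite subSS upS ?leq_subr // -subSn // => /andP[/(IH (ltnW mi)) mS xm].
by apply: stS xm mS; rewrite subSn //; apply/arcP/ArcUp; rewrite leq_subr.
Qed.

Definition joined C i k :=
  (northern i \in C) && down i k || (southern i \in C) && up i k.

(* The locations of C together with the picking locations to which x leads
   from an end of their subaisle lying in C. *)
Definition spread C : {set location W} :=
  [set v : location W | match v with
           | inl c => c \in C
           | inr p => joined C (tag p) (tagged p).+1
           end].

(** The value later given to [gamma]: a vertical reduced arc is selected when its whole subaisle is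
    run through in that direction. *)
Definition traversal (e : artificial W * artificial W) : bool :=
  horizontal e.1 e.2 && x (inl e.1, inl e.2)
  || [exists i, (e == (northern i, southern i)) && down i (npick i).+1
                || (e == (southern i, northern i)) && up i 0].

Lemma horizontal_row {a c : artificial W} :
  horizontal a c -> a.2 = c.2 :> nat.
Proof. by rewrite /horizontal => /andP[/eqP ->]. Qed.

Lemma northern_row i : (northern i).2 = i.2 :> nat.
Proof. by rewrite /= /bump leqNgt ltn_ord. Qed.

Lemma southern_row i : (southern i).2 = i.2.+1 :> nat.
Proof. by []. Qed.

Lemma traversal_horizontal a c :
  horizontal a c -> traversal (a, c) = x (inl a, inl c).
Proof.
move=> ac; rewrite /traversal /= ac /=; case: existsP => [[i H]|]; last first.
  by rewrite orbF.
have := horizontal_row ac.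
by case/orP: H => /andP[/eqP[-> ->] _]; rewrite northern_row southern_row;
  [move=> /n_Sn | move=> /esym/n_Sn].
Qed.

Lemma southern_inj : injective (@southern W).
Proof. by case=> [a b] [a' b'] [-> /val_inj ->]. Qed.

(** Going from northern to southern end raises the cross-aisle index by one, so a downward arc of
    one subaisle is never an upward arc of another. *)
Lemma no_exchange i j : southern i = northern j -> southern j <> northern i.
Proof.
pose row (a : artificial W) : nat := a.2.
move=> /(congr1 row) ij /(congr1 row); move: ij.
rewrite /row !southern_row !northern_row => <- e.
by have := leqnSn i.2.+1; rewrite e ltnn.
Qed.

Lemma traversal_down i :
  traversal (northern i, southern i) = down i (npick i).+1.
Proof.
apply/idP/idP => [|di]; last first.
  by apply/orP; right; apply/existsP; exists i; rewrite eqxx di.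
case/orP => [/andP[/horizontal_row]|/existsP[j /orP[]/andP[/eqP ij]]].
- by rewrite northern_row southern_row => /n_Sn.
- by rewrite (southern_inj _ _ (congr1 snd ij)).
- by case: (no_exchange _ _ (congr1 snd ij) (esym (congr1 fst ij))).
Qed.

Lemma traversal_up i : traversal (southern i, northern i) = up i 0.
Proof.
apply/idP/idP => [|di]; last first.
  by apply/orP; right; apply/existsP; exists i; rewrite eqxx di orbT.
case/orP => [/andP[/horizontal_row]|/existsP[j /orP[]/andP[/eqP ij]]].
- by rewrite northern_row southern_row => /esym/n_Sn.
- by case: (no_exchange _ _ (congr1 fst ij) (esym (congr1 snd ij))).
- by rewrite (southern_inj _ _ (congr1 fst ij)).
Qed.

Section Spread.
Variable C : {set artificial W}.
Hypothesis stC : stays (E' W) traversal C.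

(** Only the two ends need an argument: a run arriving there from the opposite end is a full
    traversal, and [C] is closed under traversals. *)
Lemma site_spread i k :
  (k <= (npick i).+1)%N -> (site i k \in spread C) = joined C i k.
Proof.
case: k => [_|k].
  rewrite inE /joined andbT; apply/idP/idP => [->//|/orP[//|/andP[sC u0]]].
  by apply: stC sC; [exact/arc'P/Arc'Up | rewrite traversal_up].
rewrite ltnS leq_eqVlt => /predU1P[->|ki]; last first.
  by rewrite (site_inr ki) inE.
rewrite site_last inE /joined up_last andbT.
apply/idP/idP => [->|/orP[/andP[nC di]|//]]; first by rewrite orbT.
by apply: stC nC; [exact/arc'P/Arc'Down | rewrite traversal_down].
Qed.

(** A used vertical arc either prolongs the run that reached its tail, or points back along that
    run, whose part up to the head remains. *)
Lemma stays_spread : stays (E W) x (spread C).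
Proof.
move=> u v /arcP[i k ki|i k ki|a c ac].
- move=> xk; rewrite !site_spread ?(leqW ki) // /joined downS xk andbT (upS _ _ ki).
  case/orP=> [->//|/andP[-> /andP[-> _]]]; exact: orbT.
- move=> xk; rewrite !site_spread ?(leqW ki) // /joined downS (upS _ _ ki) xk andbT.
  case/orP=> [/andP[-> /andP[-> _]]//|->]; exact: orbT.
- rewrite -traversal_horizontal // !inE; apply: stC.
  exact/arc'P/Arc'Horizontal.
Qed.

End Spread.

End Subaisles.

Lemma arc_neq {W : warehouse} (u v : location W) : (u, v) \in E W -> u != v.
Proof.
move=> /arcP[i k ki|i k ki|a c]; first exact: site_neqS.
  by rewrite eq_sym site_neqS.
rewrite /horizontal; apply: contraTneq => -[->]; rewrite eqxx orbb.
by apply/eqP => /esym/n_Sn.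
Qed.

Lemma site_eq_inr {W : warehouse} (i : subaisle W) k (p : picking W) :
  site i k = inr p -> (tagged p).+1 = k /\ tag p = i.
Proof.
case: k => // k; have [ki|ik] := ltnP k (npick i).
  by rewrite (site_inr ki) => -[<-].
by rewrite /= insubN // -leqNgt.
Qed.

(** * From the basic model to the flow model *)

Section Reduction.
Context {R : realType} {W : warehouse}.
Context {O : finType} (b : O -> R) (L : O -> {set picking W}) (B : R) {T : nat}.

(** If a closed [S] missed the origin, it would contain both ends of the used arc leaving [v]. Hence
    (B4) applies, with [y t v] equal to 1 by (B3), and contradicts the empty cut. *)
Lemma stays_reach (x : 'I_T -> location W * location W -> bool)
    (z : O -> 'I_T -> bool) (y : 'I_T -> location W -> bool) t v :
  B3 x y -> B4 x y -> v != inl (origin W) ->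
  (exists2 w, (v, w) \in E W & x t (v, w)) ->
  forall S, stays (E W) (x t) S -> v \in S -> inl (origin W) \in S.
Proof.
move=> b3 b4 vs [w vw xvw] S stS vS; apply: contraT => sS.
have wS := stS _ _ vw xvw vS.
have S2 : (2 <= #|S|)%N by apply/card_gt1P; exists v, w; rewrite vS wS arc_neq.
have := b4 t S sS S2 v vS; rewrite (staysP _ _ _).1 // leqn0 eqb0 => /negP[].
have /b3 := vs => /(_ t (v, w)); rewrite leq_bool xvw; apply.
by rewrite mem_arcs_out vw !inE eqxx eq_sym arc_neq.
Qed.

Lemma basic_to_F (x : 'I_T -> location W * location W -> bool) y z :
  P_basic b L B x y z -> exists y' alpha beta gamma sigma,
    P_F b L B x y' z alpha beta gamma (sigma : 'I_T -> _ -> _ -> R).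
Proof.
case=> b1 b2 b3 b4 b5 b6 b7.
(* The origin is excluded because (F1) and (F3) at [v0 = s] force its value to be 0. *)
pose y' t v := (v != inl (origin W)) && [exists w, ((v, w) \in E W) && x t (v, w)].
pose alpha t (p : picking W) := down (x t) (tag p) (tagged p).+1.
pose beta t (p : picking W) := up (x t) (tag p) (tagged p).+1.
have ysN t v0 : y' t (inl v0) -> (v0 == origin W) = false.
  by case/andP=> /negbTE.
(* The factor [y'] covers both cases: a unit flow to the origin from a visited location, the zero
   flow otherwise. *)
have flows (tv : 'I_T * artificial W) : exists f : _ -> R,
    (forall e, e \in E' W -> 0 <= f e <= (traversal (x tv.1) e)%:R)
    /\ forall u, net (E' W) f u
         = (y' tv.1 (inl tv.2))%:R * ((u == tv.2)%:R - (u == origin W)%:R).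
  case: tv => t v0 /=; case yv: (y' t (inl v0)); last first.
    exists (fun=> 0); split=> [e _|u]; first by rewrite lexx ler0n.
    by rewrite mul0r /net !big1 ?subrr.
  pose r (a c : artificial W) := ((a, c) \in E' W) && traversal (x t) (a, c).
  have rs : connect r v0 (origin W).
    have stC : stays (E' W) (traversal (x t)) [set c | connect r v0 c].
      move=> a c ac tac; rewrite !inE => /connect_trans; apply.
      by apply/connect1/andP.
    case/andP: yv => vs /existsP[w /andP[vw xvw]].
    have := stays_reach x z y t _ b3 b4 vs (ex_intro2 _ _ w vw xvw) _ (stays_spread _ _ stC).
    by rewrite !inE connect0; apply.
  have [|f [f01 fnet]] := connect_flow (R := R) (E' W) r _ _ _ rs.
    by move=> u v /andP[].
  exists f; split=> [[a c] ac|u]; last by rewrite fnet mul1r.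
  by have := f01 a c; rewrite /r ac.
have [sigma sigmaP] := fin_all_exists flows.
exists y', alpha, beta, (fun t => traversal (x t)), (fun t v0 => sigma (t, v0)).
split=> //.
- split.
  + move=> t v w; rewrite (site_picking v) south_site // => /site_eq_inr[wj wi].
    rewrite leq_bool /alpha wj wi downS.
    by apply/implyP => /andP[].
  + move=> t v; rewrite (site_picking v) north_site ?(ltnW (ltn_ord _)) //.
    by rewrite leq_bool /alpha downS; apply/implyP => /andP[].
  + move=> t v w; rewrite (site_picking v) north_site ?(ltnW (ltn_ord _)) //.
    move=> /site_eq_inr[wj wi]; rewrite leq_bool /beta wj wi upS ?(ltnW (ltn_ord _)) //.
    by apply/implyP => /andP[].
  + move=> t v; rewrite (site_picking v) south_site //.
    by rewrite leq_bool /beta upS //; apply/implyP => /andP[].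
  + move=> t o v vo; case zot: (z o t) => //.
    (* With [C] the full set, the unspread locations form a closed set without the origin; by (B2)
       and [stays_reach] the served [v] is not among them. *)
    have stT : stays (E' W) (traversal (x t)) setT by [].
    have stS := staysC _ _ (b5 t) _ (stays_spread _ _ stT).
    have [w vw xvw] : exists2 w, (inr v, w) \in E W & x t (inr v, w).
      apply: contrapT => H.
      have := b2 t o v vo; rewrite zot leqNgt => /negP; apply.
      rewrite (staysP _ _ _).1 // => u w uw xuw; rewrite inE => /eqP uv.
      by case: H; exists w; rewrite -uv.
    have := stays_reach x z y t (inr v) b3 b4 isT (ex_intro2 _ _ w vw xvw) _ stS.
    rewrite !inE /joined !in_setT !andTb -/(alpha t v) -/(beta t v).
    by case: (alpha t v); case: (beta t v) => //= /(_ isT).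
- move=> t u us [v w]; rewrite mem_arcs_out in_set1 => /and3P[vw /eqP vu _].
  rewrite leq_bool /y'; apply/implyP => xvw; apply/andP; split=> //.
  by apply/existsP; exists w; rewrite -vu vw.
- by move=> t v w vw; rewrite traversal_horizontal.
- move=> t i l; rewrite leq_bool traversal_down downS north_southern site_last; split.
    move=> v /site_eq_inr[vj vi]; rewrite /alpha vj vi leq_bool.
    by apply/implyP => /andP[].
  by apply/implyP => /andP[].
- move=> t i f; rewrite leq_bool traversal_up south_northern upS //; split.
    move=> v /site_eq_inr[vj vi]; rewrite /beta vj vi leq_bool.
    by apply/implyP => /andP[].
  by apply/implyP => /andP[].
- move=> t v0; apply: (etrans (proj2 (sigmaP (t, v0)) v0)); rewrite eqxx.
  by have [|_] := boolP (y' t (inl v0)) => [/ysN ->|]; rewrite ?subr0 ?mulr1 ?mul0r.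
- move=> t v0 u us uv; apply: (etrans (proj2 (sigmaP (t, v0)) u)).
  by rewrite (negbTE us) (negbTE uv) subrr mulr0.
- move=> t v0; apply: (etrans (proj2 (sigmaP (t, v0)) (origin W))).
  rewrite eqxx eq_sym.
  have [|_] := boolP (y' t (inl v0)) => [/ysN ->|]; first by rewrite sub0r mul1r.
  by rewrite mul0r oppr0.
- by move=> t v0 e /(proj1 (sigmaP (t, v0))).
Qed.

(** * From the flow model to the basic model *)

Section FromF.
Context {x : 'I_T -> location W * location W -> bool}.
Context {y : 'I_T -> location W -> bool} {z : O -> 'I_T -> bool}.
Context {alpha beta : 'I_T -> picking W -> bool}.
Context {gamma : 'I_T -> artificial W * artificial W -> bool}.
Context {sigma : 'I_T -> artificial W -> artificial W * artificial W -> R}.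
Hypothesis PF : P_F b L B x y z alpha beta gamma sigma.

(** The chain constraints carry [alpha] north to the first picking location, and each value forces
    the arc entering from the north. *)
Lemma alpha_down t p : alpha t p -> down (x t) (tag p) (tagged p).+1.
Proof.
suff H i j (ji : (j < npick i)%N) : alpha t (pick_at ji) -> down (x t) i j.+1.
  by case: p => i [j ji]; exact: H.
have arc k (ki : (k < npick i)%N) :
    alpha t (pick_at ki) -> x t (site i k, site i k.+1).
  have := sub_alpha_arc (F_sub PF) t (pick_at ki).
  by rewrite -site_inr north_site ?(ltnW ki) // leq_bool => /implyP.
elim: j ji => [|j IH] ji aj; rewrite downS arc // andbT.
have ch : south (inr (pick_at (ltnW ji))) = inr (pick_at ji).
  by rewrite -!site_inr south_site // ltnW.
by have := sub_alpha_chain (F_sub PF) t ch; rewrite leq_bool aj; exact: IH.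
Qed.

Lemma beta_up t p : beta t p -> up (x t) (tag p) (tagged p).+1.
Proof.
suff H i j (ji : (j < npick i)%N) : beta t (pick_at ji) -> up (x t) i j.+1.
  by case: p => i [j ji]; exact: H.
have arc k (ki : (k < npick i)%N) :
    beta t (pick_at ki) -> x t (site i k.+2, site i k.+1).
  have := sub_beta_arc (F_sub PF) t (pick_at ki).
  by rewrite -site_inr south_site // leq_bool => /implyP.
(* [m] counts the picking locations south of position [j.+1]; the induction runs toward the southern
   end. *)
have [m jm] : exists m, (j.+1 + m = npick i)%N.
  by exists (npick i - j.+1)%N; rewrite subnKC.
elim: m j ji jm => [|m IH] j ji jm bj; rewrite upS // arc // andbT.
  by rewrite -{1}[j.+1]addn0 jm up_last.
have ji' : (j.+1 < npick i)%N by rewrite -jm addnS ltnS leq_addr.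
apply: (IH _ ji'); first by rewrite -jm addnS.
have ch : north (inr (pick_at ji')) = inr (pick_at ji).
  by rewrite -!site_inr north_site // ltnW.
by have := sub_beta_chain (F_sub PF) t ch; rewrite leq_bool bj.
Qed.

Lemma gamma_down t i :
  gamma t (northern i, southern i) -> down (x t) i (npick i).+1.
Proof.
move=> g; have [ga gx] := F_G3 PF t i; rewrite downS; apply/andP; split.
  case: (posnP (npick i)) => [->//|]; case n: (npick i) => [//|k] _.
  have ki : (k < npick i)%N by rewrite n.
  have := ga (pick_at ki); rewrite north_southern n => /(_ (site_inr ki)).
  by rewrite leq_bool g => /alpha_down.
by move: gx; rewrite leq_bool g north_southern -site_last.
Qed.

Lemma gamma_up t i : gamma t (southern i, northern i) -> up (x t) i 0.
Proof.
move=> g; have [ga gx] := F_G4 PF t i; rewrite upS //; apply/andP; split.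
  have [n0|n0] := posnP (npick i); first by have := up_last (x t) i; rewrite n0.
  have := ga (pick_at n0); rewrite south_northern => /(_ (site_inr n0)).
  by rewrite leq_bool g => /beta_up.
by move: gx; rewrite leq_bool g south_northern.
Qed.

Definition reach t : {set location W} :=
  [set v | connect (fun u w => ((u, w) \in E W) && x t (u, w)) (inl (origin W)) v].

Lemma stays_reach_set t : stays (E W) (x t) (reach t).
Proof.
move=> u v uv xuv; rewrite !inE => /connect_trans; apply.
by apply/connect1/andP.
Qed.

Lemma stays_unreach t : stays (E W) (x t) (~: reach t).
Proof. exact: staysC (F_B5 PF t) _ (@stays_reach_set t). Qed.

Lemma origin_reach t : inl (origin W) \in reach t.
Proof. by rewrite inE connect0. Qed.

(** A cut argument: if [f] were unreached, one unit of flow would have to leave the set of unreached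
    artificial locations. No [gamma] arc leaves it, since such an arc stands for a run of [x] and
    the unreached locations are closed under [x]. *)
Lemma left_artificial_reach t (f : artificial W) w :
  (inl f, w) \in E W -> x t (inl f, w) -> inl f \in reach t.
Proof.
move=> fw xfw; have [->|fs] := eqVneq f (origin W); first exact: origin_reach.
have yf : y t (inl f).
  have := F_G1 PF t fs (e := (inl f, w)).
  by rewrite mem_arcs_out fw !in_set1 eqxx eq_sym arc_neq // leq_bool xfw; apply.
apply: contraT => fR.
pose C := [set c | inl c \notin reach t].
have inC c : (c \in C) = (inl c \in ~: reach t) by rewrite in_setC in_set.
have fC : f \in C by rewrite inC in_setC.
have g0 a c : (a, c) \in E' W -> a \in C -> c \notin C -> gamma t (a, c) = false.
  have stU := stays_unreach t.
  rewrite !inC => ac aU; apply: contraNF => g.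
  case/arc'P: ac aU g => [i|i|{}a {}c ac] aU g.
  - by have := stays_down _ _ _ _ (leqnn _) stU aU (gamma_down t i g); rewrite site_last.
  - exact: stays_up _ _ _ 0%N isT stU aU (gamma_up t i g).
  - apply: stU aU; first exact/arcP/ArcHorizontal.
    by rewrite (F_G2 PF).
(* Summed over [C], the net outflow is 1: [f] contributes [y t (inl f)], and other members
   contribute 0 because the origin is outside [C]. *)
have := sum_cut_difference (E' W) _ (sigma t f) C.
rewrite (bigD1 f) //= [X in X + _](F_F1 PF t f) yf.
rewrite big1 ?addr0 => [e|u /andP[uC uf]]; last first.
  apply: (F_F2 PF t) => //; apply: contraTneq uC => ->.
  by rewrite inC in_setC negbK origin_reach.
have := ltr01 (R := R); rewrite ltNge => /negP; case.
rewrite [leLHS]e subr_le0; apply: (@le_trans _ _ 0).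
  apply: sumr_le0 => -[a c]; rewrite mem_arcs_out => /and3P[ac aC cC].
  by have /andP[_] := F_F4 PF t f ac; rewrite g0.
by apply: sumr_ge0 => e'; rewrite in_set => /andP[e'E _]; have /andP[] := F_F4 PF t f e'E.
Qed.

(** The run to [p] given by [alpha] or [beta] starts with a used arc out of an end of the subaisle,
    so that end is reached and the run leads on to [p]. *)
Lemma served_reach t o p : p \in L o -> z o t -> inr p \in reach t.
Proof.
move=> po zo; have := sub_cover (F_sub PF) t po; rewrite zo.
have ni : (tagged p <= npick (tag p))%N by exact: ltnW.
move=> ab; have /orP[/alpha_down dp|/beta_up ub] : alpha t p || beta t p.
  by move: ab; case: (alpha t p); case: (beta t p).
  have nR : inl (northern (tag p)) \in reach t.
    apply: left_artificial_reach (down_first _ _ _ dp).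
    exact/arcP/(ArcDown (tag p) 0 (leq0n _)).
  rewrite site_picking; apply: stays_down nR dp => //; exact: stays_reach_set.
have sR : inl (southern (tag p)) \in reach t.
  move: (up_first _ _ _ (ltn_ord _) ub); rewrite site_last.
  by apply: left_artificial_reach; rewrite -site_last; apply/arcP; apply: ArcUp.
rewrite site_picking; apply: stays_up sR ub => //; exact: stays_reach_set.
Qed.

Lemma F_to_basic :
  exists x' y', P_basic b L B x' y' z /\ forall t e, x' t e -> x t e.
Proof.
(* Testing the tail suffices, since the reached set is closed under [x t]. *)
pose x' t (e : location W * location W) := x t e && (e.1 \in reach t).
exists x', (fun t u => u \in reach t); split; last by move=> t e /andP[].
(* At a reached location all used arcs are kept, because none enters from an unreached one; at an
   unreached location none is kept. *)
have bal : B5 x'.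
  move=> t v; have [vR|vR] := boolP (v \in reach t).
    transitivity (\sum_(e in delta_out [set v]) x t e)%N.
      apply: eq_bigr => -[u w]; rewrite mem_arcs_out in_set1 => /and3P[_ /eqP uv _].
      by rewrite /x' /= uv vR andbT.
    rewrite (F_B5 PF); apply: eq_bigr => -[u w].
    rewrite in_set /x' => /and3P[uw _]; rewrite in_set1 /= => /eqP wv.
    case xuw: (x t (u, w)) => //; suff -> : u \in reach t by [].
    apply: contraT => uR; have := stays_unreach t _ _ uw xuw.
    by rewrite !in_setC wv vR => /(_ uR).
  rewrite !big1 // => -[u w]; rewrite in_set /= => /and3P[uw].
    move=> _; rewrite in_set1 => /eqP wv.
    apply/eqP; rewrite eqb0; apply: contra vR => /andP[xuw uR].
    by rewrite -wv; exact: stays_reach_set _ _ _ uw xuw uR.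
  by rewrite in_set1 => /eqP uv _; rewrite /x' /= uv (negbTE vR) andbF.
have cutR t (S : {set location W}) u : inl (origin W) \notin S -> u \in S -> u \in reach t ->
    (0 < \sum_(e in delta_out S) x' t e)%N.
  move=> sS uS uR; apply: cut_gt0 => stS.
  have stSR : stays (E W) (x' t) (S :&: reach t).
    move=> v w vw xvw; rewrite !in_setI => /andP[vS vR].
    rewrite (stS _ _ vw xvw vS); case/andP: xvw => xvw _.
    exact: stays_reach_set _ _ _ vw xvw vR.
  (* By balance of [x'], the complement of [S :&: reach t] is closed as well. So the part of the
     reached set outside [S] is closed under [x t] and contains the origin, hence also [u], a
     contradiction. *)
  have st : stays (E W) (x t) (reach t :\: S).
    move=> v w vw xvw; rewrite !in_setD => /andP[vS vR].
    have wR := stays_reach_set _ _ _ vw xvw vR.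
    have xv' : x' t (v, w) by rewrite /x' xvw.
    have := staysC _ _ (bal t) _ stSR _ _ vw xv'.
    by rewrite !in_setC !in_setI vR wR !andbT; apply.
  move: uR; rewrite inE => /connect_stays/(_ st).
  by rewrite !in_setD sS uS origin_reach => /(_ isT).
split=> //; try by case: PF.
- move=> t; apply: leq_trans (F_B1 PF t) _; apply: leq_sum => -[u w].
  rewrite mem_arcs_out in_set1 => /and3P[_ /eqP us _].
  by rewrite /x' /= us origin_reach andbT.
- move=> t o u uo; case zo: (z o t) => //; apply: (cutR t _ (inr u)).
  + by rewrite in_set1.
  + by rewrite in_set1.
  + exact: served_reach uo zo.
- move=> t u us [v w]; rewrite mem_arcs_out in_set1 => /and3P[_ /eqP <- _].
  by rewrite leq_bool; apply/implyP => /andP[].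
- move=> t S sS _ u uS; case uR: (u \in reach t) => //; exact: cutR uS uR.
Qed.

End FromF.

(** * Feasibility and existence of the minimum *)

(** Every picker uses every arc: symmetry of [E W] gives balance, and connection to the origin makes
    every cut avoiding it positive. The packing supplies [z]. *)
Lemma packable_basic : packable b B T ->
  exists y z, P_basic b L B (fun (_ : 'I_T) (_ : location W * location W) => true) y z.
Proof.
case=> g gB; exists (fun _ _ => true), (fun o t => g o == t).
have cut (S : {set location W}) u (t : 'I_T) : inl (origin W) \notin S -> u \in S ->
    (0 < \sum_(e in delta_out S) true)%N.
  move=> sS uS; apply: cut_gt0 => stS.
  by rewrite (stays_origin _ _ stS uS) in sS.
split=> //.
- move=> t; apply: cut_gt0 => stS.
  have := stS (inl (origin W)) (south (inl (origin W))).
  (* The top-left subaisle provides an arc leaving the origin. *)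
  pose i : subaisle W := (Ordinal (aisles_gt0 W), Ordinal (blocks_gt0 W)).
  have -> : inl (origin W) = site i 0.
    by congr (inl (_, _)); apply: val_inj; rewrite /= /bump leqNgt blocks_gt0.
  rewrite south_site // !in_set1 eqxx eq_sym (negbTE (site_neqS i 0 _)) //.
  by move=> /(_ _ isT isT) H; have : false by apply: H; apply/arcP/ArcDown.
- move=> t o u uo; apply: leq_trans (cut [set inr u] (inr u) t _ _); rewrite ?leq_b1 ?in_set1 //.
- by move=> t S sS _ u uS; apply: cut uS.
- move=> t v; pose swap (e : location W * location W) := (e.2, e.1).
  have swapK : involutive swap by case.
  rewrite (reindex_inj (inv_inj swapK)); apply: eq_bigl => -[u w].
  rewrite [swap _]/= mem_arcs_out [RHS]in_set /= (andbC (u \notin _)).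
  by congr (_ && _); apply/idP/idP; exact: E_sym.
- move=> o; rewrite (bigD1 (g o)) //= eqxx big1 // => t /negbTE.
  by rewrite eq_sym => ->.
- move=> t; apply: le_trans (gB t); rewrite [leRHS]big_mkcond.
  by apply: ler_sum => o _; case: eqP; rewrite ?mulr1 ?mulr0.
Qed.

Lemma le_cost (d : location W * location W -> R)
    (x x' : 'I_T -> location W * location W -> bool) :
  (forall e, e \in E W -> 0 < d e) ->
  (forall t e, x' t e -> x t e) -> cost d x' <= cost d x.
Proof.
move=> d0 le; apply: ler_sum => t _; apply: ler_sum => e /d0/ltW eE.
by apply: ler_wpM2l; rewrite // ler_nat leq_bool; apply/implyP/le.
Qed.

End Reduction.

Lemma finite_range_min {R : realType} {I : finType} (f : I -> R) (A : R -> Prop) :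
  (forall a, A a -> exists i, a = f i) -> (exists a, A a) ->
  exists m, is_min A m.
Proof.
move=> fA [a Aa]; have [i0 a0] := fA a Aa.
have Pi0 : `[< A (f i0) >] by apply/asboolP; rewrite -a0.
case: (Order.TotalTheory.arg_minP (P := fun i => `[< A (f i) >]) f Pi0) => i /asboolP Afi lei.
exists (f i); split=> // c Ac; have [j cj] := fA c Ac.
by rewrite cj; apply: lei; apply/asboolP; rewrite -cj.
Qed.

Theorem theorem4p3 (R : realType) (W : warehouse)
  (d : location W * location W -> R)
  (d_sym : forall u v, (u, v) \in E W -> d (u, v) = d (v, u))
  (d_gt0 : forall e, e \in E W -> 0 < d e)
  (O : finType) (b : O -> R) (L : O -> {set picking W}) (B : R)
  (T : nat) (T_min : min_bins b B T) :
  exists m : R, is_min (F_value d b L B T) m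
                /\ is_min (basic_value d b L B T) m.
Proof.
(* The cost depends on [x] alone; coding [x] as a finite family of sets makes the possible costs
   finite in number. *)
pose val (v : {ffun 'I_T -> {set location W * location W}}) :=
  cost d (fun t e => e \in v t).
have [||m [[x [y [z [Pb mx]]]] mmin]] := finite_range_min val (basic_value d b L B T).
- move=> _ [x [y [z [_ ->]]]]; exists [ffun t => [set e | x t e]].
  apply: eq_bigr => t _; apply: eq_bigr => e _; by rewrite ffunE inE.
- have [y [z P]] := packable_basic b L B T_min.1.
  by eexists; exists (fun _ _ => true), y, z; split; first exact: P.
exists m; split; last by split=> //; exists x, y, z.
(* The basic optimum lifts with the same [x], and every flow solution yields a basic one of no
   larger cost. *)
split.
  have [y' [al [be [ga [si PF]]]]] := basic_to_F b L B x y z Pb.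
  by exists x, y', z, al, be, ga, si.
move=> _ [x1 [y1 [z1 [al [be [ga [si [PF ->]]]]]]]].
have [x' [y' [Pb' le]]] := F_to_basic b L B PF.
apply: le_trans (le_cost d x1 x' d_gt0 le); apply: mmin.
by exists x', y', z1.
Qed.
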